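(* Let $U$ be an entrywise nonnegative real matrix indexed by a finite set $E$. If $$\forall v\in\mathbb{R}^E:\quad \langle (Uv-1)^+,v\rangle=\sum_{j\in E}\Big(\sum_{k\in E}U_{jk}v_k-1\Big)^+v_j\ \ge\ 0,\qquad(\ast)$$ then $U$ is a potential. Conversely, if both $U$ and its transpose $U^t$ are potential matrices (for example, if $U$ is a symmetric potential), then $(\ast)$ holds.
   Context: A nonnegative matrix $U$ indexed by a finite set $E$ is called a potential (potential matrix) if it satisfies the Complete Maximum Principle: for all $v\in\mathbb{R}^E$, if $(Uv)_j\le 1$ at every coordinate $j$ where $v_j\ge 0$, then $(Uv)_j\le 1$ at all coordinates $j\in E$. $\langle\cdot,\cdot\rangle$ is the Euclidean inner product on $\mathbb{R}^E$, $1$ denotes the all-ones vector, and $a^+=\max(a,0)$ is taken entrywise. *)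

(* Defs.v *)
From mathcomp Require Import all_boot all_order all_algebra reals.

Set Implicit Arguments.
Unset Strict Implicit.
Unset Printing Implicit Defensive.

Import Order.TTheory GRing.Theory Num.Theory.
Local Open Scope ring_scope.

(* A matrix indexed by an arbitrary finite set E is a function E -> E -> R and
   a vector of R^E is a function E -> R, since MathComp matrices are indexed
   by ordinals only. *)

Definition nonneg_matrix (R : realType) (E : finType) (U : E -> E -> R) : Prop :=
  forall j k : E, 0 <= U j k.

Definition transpose (R : realType) (E : finType) (U : E -> E -> R) : E -> E -> R :=
  fun j k => U k j.

Definition mulmv (R : realType) (E : finType) (U : E -> E -> R) (v : E -> R) : E -> R :=
  fun j => \sum_(k : E) U j k * v k.

Definition inner (R : realType) (E : finType) (u v : E -> R) : R :=
  \sum_(j : E) u j * v j.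

Definition pos_part (R : realType) (E : finType) (u : E -> R) : E -> R :=
  fun j => Num.max (u j) 0.

Definition complete_maximum_principle (R : realType) (E : finType)
    (U : E -> E -> R) : Prop :=
  forall v : E -> R,
    (forall j : E, 0 <= v j -> mulmv U v j <= 1) ->
    forall j : E, mulmv U v j <= 1.

Definition potential (R : realType) (E : finType) (U : E -> E -> R) : Prop :=
  nonneg_matrix U /\ complete_maximum_principle U.

(* Main.v *)
Require Import Defs.
From mathcomp Require Import all_boot all_order all_algebra reals.
From mathcomp Require Import lra.
Set Implicit Arguments.
Unset Strict Implicit.
Import Order.TTheory GRing.Theory Num.Theory.
Local Open Scope ring_scope.

(** If the condition on [(Uv - 1)^+] holds and [Uv <= 1] wherever [v >= 0],
    then [<(Uv - 1)^+, v>] is a sum of nonpositive terms with nonnegative total,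
    so every term vanishes, and [Uv <= 1] wherever [v < 0] as well
    ([cmp_of_inner_ge0]).

    For the converse, suppose first that [U] is invertible.  By the layer cake
    formula [layer_cake_ge0] it is enough that [v] has nonnegative sum over each
    level set [A = {Uv > t}] with [t >= 0].  Choose [mu] with [U^t mu = 1_A] and
    [h] with [U h = 1].  The maximum principle for [U^t] makes [mu] nonnegative
    on [A] and nonpositive off [A]; the one for [U] makes [h] nonnegative.  Hence
    [sum_A v = <mu, Uv> >= t * sum mu = t * <mu, U h> = t * sum_A h >= 0]
    ([level_set_sum_ge0]).

    A potential may be singular, so this is applied to [U + e I], which
    is invertible for [e > 0].  Since
    [<(Uv + e v - 1)^+, v> <= <(Uv - 1)^+, v> + e <v, v>], letting [e] tend to
    [0] gives the result for [U]. *)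

Definition shift (R : realType) (E : finType) (e : R) (U : E -> E -> R) :
    E -> E -> R :=
  fun j k => U j k + e * (j == k)%:R.

Lemma mulmv_shift (R : realType) (E : finType) (e : R) (U : E -> E -> R)
    (v : E -> R) (j : E) :
  mulmv (shift e U) v j = mulmv U v j + e * v j.
Proof.
rewrite /mulmv /shift.
under eq_bigr do rewrite mulrDl.
rewrite big_split /=; congr (_ + _).
rewrite (bigD1 j) //= eqxx mulr1 big1 ?addr0 // => k kj.
by rewrite eq_sym (negbTE kj) mulr0 mul0r.
Qed.

Lemma mulmv_transpose_shift (R : realType) (E : finType) (e : R)
    (U : E -> E -> R) (v : E -> R) (j : E) :
  mulmv (transpose (shift e U)) v j = mulmv (transpose U) v j + e * v j.
Proof.
rewrite -mulmv_shift; apply: eq_bigr => k _.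
by rewrite /transpose /shift eq_sym.
Qed.

Lemma mulmvZ (R : realType) (E : finType) (U : E -> E -> R) (a : R)
    (v : E -> R) (j : E) :
  mulmv U (fun k => a * v k) j = a * mulmv U v j.
Proof. by rewrite /mulmv mulr_sumr; apply: eq_bigr => k _; rewrite mulrCA. Qed.

Lemma mulmvN (R : realType) (E : finType) (U : E -> E -> R) (v : E -> R)
    (j : E) :
  mulmv U (fun k => - v k) j = - mulmv U v j.
Proof. by rewrite /mulmv -sumrN; apply: eq_bigr => k _; rewrite mulrN. Qed.

Lemma inner_transpose (R : realType) (E : finType) (U : E -> E -> R)
    (u v : E -> R) :
  inner (mulmv (transpose U) u) v = inner u (mulmv U v).
Proof.
rewrite /inner /mulmv /transpose.
under eq_bigr do rewrite mulr_suml.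
rewrite exchange_big /=; apply: eq_bigr => k _.
by rewrite mulr_sumr; apply: eq_bigr => j _; rewrite mulrAC mulrC mulrA.
Qed.

Lemma inner_indicator (R : realType) (E : finType) (A : pred E) (v : E -> R) :
  inner (fun j => (A j)%:R) v = \sum_(j | A j) v j.
Proof.
rewrite /inner [RHS]big_mkcond /=; apply: eq_bigr => j _.
by case: (A j); rewrite ?mul1r ?mul0r.
Qed.

Lemma mulmv_surjective (R : realType) (E : finType) (U : E -> E -> R) :
  (forall v, (forall j, mulmv U v j = 0) -> forall j, v j = 0) ->
  forall b : E -> R, exists v, forall j, mulmv U v j = b j.
Proof.
move=> injU b.
pose M : 'M[R]_#|E| := \matrix_(k, j) U (enum_val j) (enum_val k).
have mulM (x : 'rV_#|E|) j :
    (x *m M) 0 (enum_rank j) = mulmv U (fun k => x 0 (enum_rank k)) j.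
  rewrite mxE /mulmv (reindex_onto enum_rank enum_val) /=; last first.
    by move=> i _; rewrite enum_valK.
  apply: eq_big => [k|k _]; first by rewrite enum_rankK eqxx.
  by rewrite mxE !enum_rankK mulrC.
have Mfree : M \in unitmx.
  rewrite -row_free_unit; apply: inj_row_free => x xM0.
  apply/rowP => i; rewrite mxE -(enum_valK i).
  apply: (injU (fun k => x 0 (enum_rank k))) => j.
  by rewrite -mulM xM0 mxE.
pose y : 'rV_#|E| := \row_i b (enum_val i).
exists (fun k => (y *m invmx M) 0 (enum_rank k)) => j.
by rewrite -mulM mulmxKV // mxE enum_rankK.
Qed.

(** The principle is stated at level [1]; rescaling [v] gives every positive
    level, and level [0] is the limit of those. *)
Lemma cmp_level (R : realType) (E : finType) (U : E -> E -> R) (c : R)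
    (v : E -> R) :
  complete_maximum_principle U -> 0 <= c ->
  (forall j, 0 <= v j -> mulmv U v j <= c) -> forall j, mulmv U v j <= c.
Proof.
move=> cmpU c0 vc j; apply/ler_addgt0Pr => d d0.
have cd0 : 0 < c + d by rewrite ltr_wpDl.
have scale k : (mulmv U (fun k => (c + d)^-1 * v k) k <= 1)
             = (mulmv U v k <= c + d).
  by rewrite mulmvZ ler_pdivrMl // mulr1.
rewrite -scale; apply: cmpU => k.
rewrite pmulr_rge0 ?invr_gt0 // scale => /vc/le_trans; apply.
by rewrite lerDl ltW.
Qed.

(** If [U v = - e v], then [U v <= 0] wherever [v >= 0], hence everywhere; so
    [v >= 0], and [v <= 0] by symmetry. *)
Lemma shift_injective (R : realType) (E : finType) (U : E -> E -> R) (e : R)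
    (v : E -> R) :
  complete_maximum_principle U -> 0 < e ->
  (forall j, mulmv U v j + e * v j = 0) -> forall j, v j = 0.
Proof.
move=> cmpU e0.
have pos u : (forall j, mulmv U u j + e * u j = 0) -> forall j, 0 <= u j.
  move=> u0 j; have Uu k : mulmv U u k = - (e * u k).
    by apply/eqP; rewrite -addr_eq0 u0.
  have: mulmv U u j <= 0.
    apply: cmp_level => // k uk.
    by rewrite Uu oppr_le0 mulr_ge0 // ltW.
  by rewrite Uu oppr_le0 pmulr_rge0.
move=> v0 j; apply/le_anti; rewrite pos // andbT -oppr_ge0.
apply: (pos (fun k => - v k)) => k.
by rewrite mulmvN mulrN -opprD v0 oppr0.
Qed.

Lemma shift_solvable (R : realType) (E : finType) (U : E -> E -> R) (e : R)
    (b : E -> R) :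
  complete_maximum_principle U -> 0 < e ->
  exists v, forall j, mulmv U v j + e * v j = b j.
Proof.
move=> cmpU e0.
have [|v vb] := @mulmv_surjective R E (shift e U) _ b.
  move=> v v0; apply: (@shift_injective R E U e) => // j.
  by rewrite -mulmv_shift.
by exists v => j; rewrite -mulmv_shift.
Qed.

(** Both halves rewrite [U v] as [1_A - e v].  It is at most [1] wherever
    [v >= 0], hence everywhere, which gives [v >= 0] on [A]; and its opposite
    is at most [0] wherever [v <= 0], hence everywhere, which gives [v <= 0]
    off [A]. *)
Lemma shift_solution_sign (R : realType) (E : finType) (U : E -> E -> R)
    (e : R) (A : pred E) (v : E -> R) :
  complete_maximum_principle U -> 0 < e ->
  (forall j, mulmv U v j + e * v j = (A j)%:R) ->
  forall j, if A j then 0 <= v j else v j <= 0.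
Proof.
move=> cmpU e0 vA j.
have Uv k : mulmv U v k = (A k)%:R - e * v k by rewrite -vA addrK.
case: ifP => Aj.
  have: mulmv U v j <= 1.
    apply: cmpU => k vk; rewrite Uv lerBlDr; apply: ler_wpDr.
      by rewrite mulr_ge0 // ltW.
    by rewrite lern1 leq_b1.
  by rewrite Uv Aj gerBl pmulr_rge0.
have: mulmv U (fun k => - v k) j <= 0.
  apply: cmp_level => // k; rewrite oppr_ge0 => vk.
  by rewrite mulmvN oppr_le0 Uv subr_ge0 (le_trans _ (ler0n _ _)) // pmulr_rle0.
by rewrite mulmvN Uv Aj sub0r opprK pmulr_rle0.
Qed.

(** With [mu] and [h] the solutions of [(U + e I)^t mu = 1_A] and
    [(U + e I) h = 1], the signs of [mu] give
    [mu_j (w_j - t) >= 0] for all [j], where [w = (U + e I) v]. *)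
Lemma level_set_sum_ge0 (R : realType) (E : finType) (U : E -> E -> R)
    (e t : R) (v : E -> R) :
  complete_maximum_principle U -> complete_maximum_principle (transpose U) ->
  0 < e -> 0 <= t -> 0 <= \sum_(j | t < mulmv (shift e U) v j) v j.
Proof.
move=> cmpU cmpUt e0 t0.
set A : pred E := fun j => t < mulmv (shift e U) v j.
have [mu muA] := @shift_solvable R E _ e (fun j => (A j)%:R) cmpUt e0.
have [h h1] := @shift_solvable R E U e (fun=> 1) cmpU e0.
have h0 j : 0 <= h j.
  exact: (@shift_solution_sign R E U e xpredT h cmpU e0 h1 j).
have pair u : \sum_(j | A j) u j = inner mu (mulmv (shift e U) u).
  rewrite -inner_transpose -inner_indicator; apply: eq_bigr => j _.
  by rewrite mulmv_transpose_shift muA.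
have mass : 0 <= \sum_j mu j.
  have -> : \sum_j mu j = \sum_(j | A j) h j.
    rewrite pair; apply: eq_bigr => j _.
    by rewrite mulmv_shift h1 mulr1.
  exact: sumr_ge0.
apply: le_trans (mulr_ge0 t0 mass) _.
rewrite pair mulr_sumr; apply: ler_sum => j _; rewrite mulrC.
have := @shift_solution_sign R E _ e A mu cmpUt e0 muA j.
case: ifP => Aj muj; first by rewrite ler_wpM2l // ltW.
by rewrite ler_wnM2l // leNgt; apply/negbT.
Qed.

(** Induction on the support [A] of [g]: with [m] the least value of [g] on
    [A], one has [g = m 1_A + (g - m)^+], and [(g - m)^+] has a smaller support
    while its level sets are level sets of [g]. *)
Lemma layer_cake_ge0 (R : realType) (E : finType) (g v : E -> R) :
  (forall j, 0 <= g j) ->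
  (forall t, 0 <= t -> 0 <= \sum_(j | t < g j) v j) -> 0 <= inner g v.
Proof.
have [n] := ubnP #|[pred j | 0 < g j]|; elim: n g => // n IH g.
rewrite ltnS => gn g0 lev.
have [i gi|gle0] := pickP [pred j | 0 < g j]; last first.
  rewrite /inner big1 // => j _.
  have -> : g j = 0 by apply/le_anti; rewrite g0 leNgt andbT; apply/negbT/gle0.
  by rewrite mul0r.
have [k /= gk kmin] := @Order.TotalTheory.arg_minP _ _ _ i [pred j | 0 < g j] g gi.
pose g' j := Num.max (g j - g k) 0.
have g'E t j : 0 <= t -> (t < g' j) = (t + g k < g j).
  by move=> t0; rewrite lt_max ltrBrDr (le_gtF t0) orbF.
have split_g : inner g v = g k * (\sum_(j | 0 < g j) v j) + inner g' v.
  rewrite /inner mulr_sumr [X in X + _]big_mkcond -big_split /=; apply: eq_bigr => j _.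
  have [gj|gj] := ltP 0 (g j).
    by rewrite /g' max_l ?subr_ge0 ?kmin //= -mulrDl addrC subrK.
  rewrite /g' max_r; last by rewrite subr_le0 (le_trans gj) // ltW.
  have -> : g j = 0 by apply/le_anti; rewrite g0 gj.
  by rewrite !mul0r addr0.
rewrite split_g addr_ge0 ?mulr_ge0 ?lev //.
apply: IH => [|j|t t0]; last first.
- under eq_bigl do rewrite g'E //.
  by rewrite lev // addr_ge0.
- by rewrite /g' le_max lexx orbT.
apply: leq_trans gn; apply: proper_card; apply/properP; split.
  apply/subsetP => j; rewrite !inE g'E // add0r; exact: lt_trans.
by exists k; rewrite inE ?gk // g'E // add0r ltxx.
Qed.

Lemma inner_pos_part_shift_ge0 (R : realType) (E : finType) (U : E -> E -> R)
    (e : R) (v : E -> R) :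
  complete_maximum_principle U -> complete_maximum_principle (transpose U) ->
  0 < e -> 0 <= inner (pos_part (fun j => mulmv (shift e U) v j - 1)) v.
Proof.
move=> cmpU cmpUt e0; apply: layer_cake_ge0 => [j|t t0].
  by rewrite /pos_part le_max lexx orbT.
have lev j : (t < pos_part (fun j => mulmv (shift e U) v j - 1) j)
           = (t + 1 < mulmv (shift e U) v j).
  by rewrite /pos_part lt_max ltrBrDr (le_gtF t0) orbF.
under eq_bigl do rewrite lev.
by apply: level_set_sum_ge0; rewrite // addr_ge0.
Qed.

Lemma inner_pos_part_ge0 (R : realType) (E : finType) (U : E -> E -> R)
    (v : E -> R) :
  complete_maximum_principle U -> complete_maximum_principle (transpose U) ->
  0 <= inner (pos_part (fun j => mulmv U v j - 1)) v.
Proof.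
move=> cmpU cmpUt.
set S := inner _ v.
have vv0 : 0 <= inner v v by apply: sumr_ge0 => j _; rewrite -expr2 sqr_ge0.
have bound e : 0 < e -> 0 <= S + e * inner v v.
  move=> e0; apply: le_trans (@inner_pos_part_shift_ge0 R E U e v _ _ e0) _ => //.
  rewrite /S /inner mulr_sumr -big_split /=; apply: ler_sum => j _.
  rewrite /pos_part mulmv_shift.
  set a := mulmv U v j; set x := v j.
  (* The positive part is 1-Lipschitz, so adding [e * x] to its argument moves
     it by at most [e * `|x|]; the sign of [x] decides which side is used. *)
  have [x0|x0] := leP 0 x.
    have -> : e * (x * x) = (e * x) * x by rewrite mulrA.
    rewrite -mulrDl ler_wpM2r // ge_max.
    have ex0 : 0 <= e * x by rewrite mulr_ge0 // ltW.
    by case: (leP (a - 1) 0) => ?; apply/andP; split; lra.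
  have -> : e * (x * x) = (e * x) * x by rewrite mulrA.
  rewrite -mulrDl ler_wnM2r ?(ltW x0) //.
  have ex0 : e * x < 0 by rewrite pmulr_rlt0.
  by case: (leP (a - 1) 0) => ?; case: (leP (a + e * x - 1) 0) => ?; lra.
apply/ler_addgt0Pr => d d0.
(* Adding [1] to [<v, v>] keeps the chosen [e] positive when [v = 0]. *)
have den0 : 0 < inner v v + 1 by rewrite ltr_wpDl.
apply: le_trans (bound (d / (inner v v + 1)) _) _; first exact: divr_gt0.
rewrite lerD2l mulrAC ler_pdivrMr // ler_wpM2l ?ltW //.
by rewrite ltrDl ltr01.
Qed.

Lemma cmp_of_inner_ge0 (R : realType) (E : finType) (U : E -> E -> R) :
  (forall v, 0 <= inner (pos_part (fun j => mulmv U v j - 1)) v) ->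
  complete_maximum_principle U.
Proof.
move=> star v v1.
have term_le0 j : pos_part (fun j => mulmv U v j - 1) j * v j <= 0.
  rewrite /pos_part; have [vj|vj] := leP 0 (v j).
    by rewrite max_r ?mul0r // subr_le0 v1.
  by rewrite nmulr_lle0 // le_max lexx orbT.
have sum0 : inner (pos_part (fun j => mulmv U v j - 1)) v = 0.
  by apply/le_anti; rewrite star andbT; apply: sumr_le0.
move=> j; have [vj|vj] := leP 0 (v j); first exact: v1.
have : pos_part (fun j => mulmv U v j - 1) j * v j = 0.
  apply/oppr_inj; rewrite oppr0.
  apply: (psumr_eq0P (P := predT)
    (F := fun k => - (pos_part (fun j => mulmv U v j - 1) k * v k))) => //.
    by move=> k _; rewrite oppr_ge0.
  by rewrite sumrN -/(inner _ v) sum0 oppr0.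
move/eqP; rewrite mulf_eq0 (lt_eqF vj) orbF => /eqP g0.
by rewrite -subr_le0 -g0 /pos_part le_max lexx.
Qed.

Unset Implicit Arguments.
Set Strict Implicit.

Theorem propositionA1 (R : realType) (E : finType) (U : E -> E -> R)
    (hU : nonneg_matrix U) :
  ((forall v : E -> R, 0 <= inner (pos_part (fun j => mulmv U v j - 1)) v) ->
     potential U) /\
  (potential U -> potential (transpose U) ->
     forall v : E -> R, 0 <= inner (pos_part (fun j => mulmv U v j - 1)) v) /\
  ((forall j k : E, U j k = U k j) -> potential U ->
     forall v : E -> R, 0 <= inner (pos_part (fun j => mulmv U v j - 1)) v).
Proof.
split; first by move=> star; split=> //; exact: cmp_of_inner_ge0.
split=> [[_ cmpU] [_ cmpUt] v|symU [_ cmpU] v].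
  exact: inner_pos_part_ge0.
apply: inner_pos_part_ge0 => // u u1 j.
have tE k : mulmv (transpose U) u k = mulmv U u k.
  by apply: eq_bigr => i _; rewrite /transpose symU.
by rewrite tE; apply: cmpU => k uk; rewrite -tE u1.
Qed.
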